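(* Let $m>1$ and suppose the initial state $f_0$ is positive and bounded. Let $n\in\{0,1,\dots,N-1\}$. Case 1. Let $x^n,x^{n+1}\in\mathcal{Q}$ be the solutions at times $t^n$, $t^{n+1}$ of the scheme $$\frac{f_{0}(X_{i})}{m\big(\frac{f_0(X)}{\widetilde{D}_h x^{n}}\big)_{i}^{m-1}}\cdot\frac{x^{n+1}_{i}-x^{n}_{i}}{\tau}=-d_{h}\Big(\frac{f_{0}(X)}{D_{h} x^{n+1}}\Big)_{i},\quad 1\le i\le M-1,\qquad x^{n+1}_0=X_0,\ x^{n+1}_M=X_M.$$ Then the discrete energy dissipation law holds: $$\frac{E^{(1)}_{N}(x^{n+1})-E^{(1)}_{N}(x^n)}{\tau}\le-\Big\langle\frac{f_{0}(X)}{m\big(\frac{f_0(X)}{\widetilde{D}_h x^n}\big)^{m-1}}\frac{x^{n+1}-x^{n}}{\tau},\frac{x^{n+1}-x^{n}}{\tau}\Big\rangle,$$ where $E^{(1)}_{N}(x):=\Big\langle f_{0}(X),\ln\Big(\frac{f_{0}(X)}{D_{h}x}\Big)\Big\rangle_e$, with $\frac{\delta E_{N}^{(1)}(x)}{\delta x}=d_{h}\Big(\frac{f_{0}(X)}{D_{h}x}\Big)$. Case 2. Let $x^n,x^{n+1}\in\mathcal{Q}$ be the solutions at times $t^n$, $t^{n+1}$ of the scheme $$\frac{(\widetilde{D}_h x^n)^{m+1}_i}{m f_0(X_i)^{m}}\cdot\frac{x^{n+1}_{i}-x^{n}_{i}}{\tau}=d_{h}\Big(\frac{D_h x^{n+1}}{f_0(X)}\Big)_{i},\quad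 1\le i\le M-1,\qquad x^{n+1}_0=X_0,\ x^{n+1}_M=X_M.$$ Then the discrete energy dissipation law holds: $$\frac{E^{(2)}_{N}(x^{n+1})-E^{(2)}_{N}(x^n)}{\tau}\le-\Big\langle\frac{(\widetilde{D}_h x^n)^{m+1}}{m f_0(X)^{m}}\cdot\frac{x^{n+1}-x^{n}}{\tau},\frac{x^{n+1}-x^{n}}{\tau}\Big\rangle,$$ where $E^{(2)}_{N}(x):=\frac12\Big\langle\frac{D_{h}x}{f_{0}(X)},D_{h}x\Big\rangle_e$, with $\frac{\delta E_{N}^{(2)}(x)}{\delta x}=-d_{h}\Big(\frac{D_{h}x}{f_{0}(X)}\Big)$.
   Context: $\Omega\subset\mathbb{R}$ is a bounded interval with left endpoint $X_0$; $T>0$; $N,M$ are positive integers; $\tau=T/N$ is the time step, $t^n=n\tau$; $h=|\Omega|/M$ is the spatial step; $X_r=X_0+rh$ for integer and half-integer $r$ (so $X_M$ is the right endpoint of $\Omega$). $\mathcal{E}_M$ is the space of real functions $l$ on $\{X_i: i=0,\dots,M\}$, with $l_i=l(X_i)$; $\mathcal{C}_M$ is the space of real functions $\phi$ on $\{X_{i-1/2}: i=1,\dots,M\}$, with $\phi_{i-1/2}=\phi(X_{i-1/2})$. Difference operators: $D_h:\mathcal{E}_M\to\mathcal{C}_M$, $(D_hl)_{i-1/2}=(l_i-l_{i-1})/h$, $1\le i\le M$; $(d_h\phi)_i=(\phi_{i+1/2}-\phi_{i-1/2})/h$, $1\le i\le M-1$, for $\phi\in\mathcal{C}_M$; $\widetilde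 D_h:\mathcal{E}_M\to\mathcal{E}_M$, $(\widetilde D_hl)_i=(l_{i+1}-l_{i-1})/(2h)$ for $1\le i\le M-1$, $(\widetilde D_hl)_0=(4l_1-l_2-3l_0)/(2h)$, $(\widetilde D_hl)_M=(l_{M-2}-4l_{M-1}+3l_M)/(2h)$. Products, quotients, powers and logarithms of grid functions are pointwise. The function $f_0$ is evaluated at the points $X_i$ when combined with elements of $\mathcal{E}_M$, and at the half points $X_{i-1/2}$ when combined with elements of $\mathcal{C}_M$. Inner products: $\langle l,g\rangle=h\big(\tfrac12l_0g_0+\sum_{i=1}^{M-1}l_ig_i+\tfrac12l_Mg_M\big)$ for $l,g\in\mathcal{E}_M$; $\langle\phi,\varphi\rangle_e=h\sum_{i=0}^{M-1}\phi_{i+1/2}\varphi_{i+1/2}$ for $\phi,\varphi\in\mathcal{C}_M$. In the dissipation terms the endpoint contributions are zero because $x^{n+1}-x^n$ vanishes at $i=0,M$. $\delta E/\delta x$ denotes the discrete variational derivative with respect to $\langle\cdot,\cdot\rangle$, i.e. $\frac{d}{ds}E(x+sy)|_{s=0}=\langle\frac{\delta E(x)}{\delta x},y\rangle$ for all $y\in\mathcal{E}_M$ with $y_0=y_M=0$ (only interior values are relevant). Admissible set: $\mathcal{Q}=\{l\in\mathcal{E}_M: l_{i-1}<l_i \text{ for } 1\le i\le M,\ l_0=X_0,\ l_M=X_M\}$. *)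

(* Defs.v *)
From HB Require Import structures.
From mathcomp Require Import all_boot all_order all_algebra.
From mathcomp Require Import all_classical all_reals all_analysis.
Set Implicit Arguments.
Unset Strict Implicit.
Unset Printing Implicit Defensive.
Import Order.TTheory GRing.Theory Num.Theory.
Import numFieldNormedType.Exports.
Local Open Scope classical_set_scope.
Local Open Scope ring_scope.

(* The space E_M: [l i] is the value of [l] at X_i, 0 <= i <= M. *)
Definition nodal (R : realType) (M : nat) := 'I_M.+1 -> R.

(* The space C_M: [phi j] is the value of [phi] at X_{j + 1/2}, 0 <= j < M. *)
Definition halfnodal (R : realType) (M : nat) := 'I_M -> R.

(* Value at a natural-number index, 0 outside the index range.  Apart from the
   one-sided differences of [Dt_h] when M = 1, only indices in range are used. *)
Definition ev (R : realType) (n : nat) (u : 'I_n -> R) (k : nat) : R :=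
  oapp u 0 (insub k).

Section Grid.
Variables (R : realType) (X0 X1 : R) (M : nat).

Definition step : R := (X1 - X0) / M%:R.

(* f_0(X) as an element of E_M and of C_M respectively. *)
Definition at_nodes (f : R -> R) : nodal R M :=
  fun i => f (X0 + i%:R * step).

Definition at_halfnodes (f : R -> R) : halfnodal R M :=
  fun j => f (X0 + (j%:R + 2^-1) * step).

Definition D_h (l : nodal R M) : halfnodal R M :=
  fun j => (ev l j.+1 - ev l j) / step.

(* The difference lives on the interior nodes; extended by 0 to i = 0, M. *)
Definition d_h (phi : halfnodal R M) : nodal R M :=
  fun i => if (0 < i < M)%N then (ev phi i - ev phi i.-1) / step else 0.

(* For M = 1 the boundary formulas refer to the missing values l_2 and l_{-1};
   boundary values of this operator are only ever multiplied by 0. *)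
Definition Dt_h (l : nodal R M) : nodal R M :=
  fun i =>
    if i == 0%N :> nat then (4 * ev l 1 - ev l 2 - 3 * ev l 0) / (2 * step)
    else if i == M :> nat then
      (ev l (M - 2) - 4 * ev l (M - 1) + 3 * ev l M) / (2 * step)
    else (ev l i.+1 - ev l i.-1) / (2 * step).

Definition inner (l g : nodal R M) : R :=
  step * (2^-1 * l ord0 * g ord0 + \sum_(1 <= i < M) ev l i * ev g i
          + 2^-1 * l ord_max * g ord_max).

Definition inner_e (phi psi : halfnodal R M) : R :=
  step * \sum_(j < M) phi j * psi j.

Definition increasing_grid (l : nodal R M) : Prop :=
  forall i : nat, (1 <= i <= M)%N -> ev l i.-1 < ev l i.

Definition admissible (l : nodal R M) : Prop :=
  [/\ increasing_grid l, l ord0 = X0 & l ord_max = X0 + M%:R * step].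

Definition is_variational_derivative
    (E : nodal R M -> R) (x g : nodal R M) : Prop :=
  forall y : nodal R M, y ord0 = 0 -> y ord_max = 0 ->
    is_derive (0 : R) (1 : R) (fun s : R => E (fun i => x i + s * y i))
      (inner g y).

Variables (f0 : R -> R) (m tau : R).

Definition energy1 (x : nodal R M) : R :=
  inner_e (at_halfnodes f0) (fun j => ln (at_halfnodes f0 j / D_h x j)).

Definition energy2 (x : nodal R M) : R :=
  2^-1 * inner_e (fun j => D_h x j / at_halfnodes f0 j) (D_h x).

(* The factors f_0 / (m (f_0 / Dt_h x)^{m-1}) and (Dt_h x)^{m+1} / (m f_0^m)
   multiplying the discrete velocity in the two schemes. *)
Definition mobility1 (x : nodal R M) : nodal R M :=
  fun i => at_nodes f0 i / (m * (at_nodes f0 i / Dt_h x i) `^ (m - 1)).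

Definition mobility2 (x : nodal R M) : nodal R M :=
  fun i => Dt_h x i `^ (m + 1) / (m * at_nodes f0 i `^ m).

Definition velocity (x x' : nodal R M) : nodal R M :=
  fun i => (x' i - x i) / tau.

Definition flux1 (x : nodal R M) : halfnodal R M :=
  fun j => at_halfnodes f0 j / D_h x j.

Definition flux2 (x : nodal R M) : halfnodal R M :=
  fun j => D_h x j / at_halfnodes f0 j.

(* One time step, from [x] to [x']. *)
Definition scheme1 (x x' : nodal R M) : Prop :=
  [/\ forall i : 'I_M.+1, (1 <= i <= M - 1)%N ->
        mobility1 x i * velocity x x' i = - d_h (flux1 x') i,
      x' ord0 = X0 & x' ord_max = X0 + M%:R * step].

Definition scheme2 (x x' : nodal R M) : Prop :=
  [/\ forall i : 'I_M.+1, (1 <= i <= M - 1)%N ->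
        mobility2 x i * velocity x x' i = d_h (flux2 x') i,
      x' ord0 = X0 & x' ord_max = X0 + M%:R * step].

Definition dissipation (w x x' : nodal R M) : R :=
  inner (fun i => w i * velocity x x' i) (velocity x x').

End Grid.

(* Main.v *)
Require Import Defs.
From HB Require Import structures.
From mathcomp Require Import all_boot all_order all_algebra.
From mathcomp Require Import all_classical all_reals all_analysis.
From mathcomp Require Import ring lra.
Set Implicit Arguments.
Unset Strict Implicit.
Unset Printing Implicit Defensive.
Import Order.TTheory GRing.Theory Num.Theory.
Import numFieldNormedType.Exports.
Local Open Scope classical_set_scope.
Local Open Scope ring_scope.

(** The two energies have the common form [E x = h * \sum_j e_j ((D_h x)_j)]
    with every [e_j] convex: [e_j a = f_j ln (f_j / a)] on [a > 0] in Case 1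
    and [e_j a = a^2 / (2 f_j)] in Case 2, where [f_j > 0] is the initial
    density at the half point [X_{j+1/2}].  Everything follows from this form
    and from summation by parts ([inner_d_h]), which says that [- d_h] is the
    adjoint of [D_h] on grid functions that vanish at both ends.

    The chain rule gives the variation of [E] in the direction [y] as
    [<phi, D_h y>_e] with [phi_j = e_j' ((D_h x)_j)], that is [<- d_h phi, y>];
    this is the variational derivative ([gradient_energy_variation]).

    The energy law ([gradient_energy_dissipation]) rests on the scheme being
    implicit in [E]: its right-hand side is [d_h phi] with [phi] taken at the
    new state.  A convex function lies above its tangent at the new state, so
    [E x' - E x <= <phi, D_h (x' - x)>_e = - <d_h phi, x' - x>], and the scheme
    replaces [d_h phi] by the weight times the velocity.  For the logarithm the
    tangent inequality is [ln z <= z - 1]; for the quadratic energy the two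
    sides differ by a square. *)

(** * Grid functions and summation by parts *)

Lemma ev_lt (R : realType) (n : nat) (u : 'I_n -> R) (k : nat)
    (lt_kn : (k < n)%N) : ev u k = u (Ordinal lt_kn).
Proof. by rewrite /ev insubT. Qed.

Lemma ev_ord0 (R : realType) (M : nat) (u : nodal R M) : ev u 0 = u ord0.
Proof. by rewrite ev_lt; congr u; apply: val_inj. Qed.

Lemma ev_ord_max (R : realType) (M : nat) (u : nodal R M) :
  ev u M = u ord_max.
Proof. by rewrite ev_lt; congr u; apply: val_inj. Qed.

Lemma ev_comb (R : realType) (n : nat) (u v : 'I_n -> R) (s : R) (k : nat) :
  ev (fun i => u i + s * v i) k = ev u k + s * ev v k.
Proof. by rewrite /ev; case: insub => //=; rewrite mulr0 addr0. Qed.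

Lemma D_h_comb (R : realType) (X0 X1 : R) (M : nat) (u v : nodal R M) (s : R)
    (j : 'I_M) :
  D_h X0 X1 (fun i => u i + s * v i) j = D_h X0 X1 u j + s * D_h X0 X1 v j.
Proof. by rewrite /D_h !ev_comb; ring. Qed.

Lemma D_h_velocity (R : realType) (X0 X1 tau : R) (M : nat) (x x' : nodal R M)
    (j : 'I_M) :
  D_h X0 X1 (velocity tau x x') j = (D_h X0 X1 x' j - D_h X0 X1 x j) / tau.
Proof.
have evB k : ev (velocity tau x x') k = (ev x' k - ev x k) / tau.
  by rewrite /ev /velocity; case: insub => //=; rewrite subrr mul0r.
by rewrite /D_h !evB; ring.
Qed.

Lemma d_hN (R : realType) (X0 X1 : R) (M : nat) (phi : halfnodal R M) i :
  d_h X0 X1 (fun j => - phi j) i = - d_h X0 X1 phi i.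
Proof.
have evN k : ev (fun j => - phi j) k = - ev phi k.
  by rewrite /ev; case: insub => //=; rewrite oppr0.
by rewrite /d_h !evN; case: ifP => _; ring.
Qed.

Lemma abel_summation (R : comPzRingType) (a b : nat -> R) (n : nat) :
  \sum_(0 <= j < n.+1) a j * (b j.+1 - b j) =
  a n * b n.+1 - a 0%N * b 0%N
  - \sum_(1 <= i < n.+1) (a i - a i.-1) * b i.
Proof.
elim: n => [|n IHn]; first by rewrite big_nat1 big_geq //; ring.
by rewrite big_nat_recr // IHn [in RHS]big_nat_recr //=; ring.
Qed.

(** The boundary terms of the summation by parts vanish with [y]. *)
Lemma inner_d_h (R : realType) (X0 X1 : R) (M : nat) (phi : halfnodal R M)
    (y : nodal R M) : y ord0 = 0 -> y ord_max = 0 ->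
  inner X0 X1 (d_h X0 X1 phi) y = - inner_e X0 X1 phi (D_h X0 X1 y).
Proof.
case: M phi y => [|n] phi y y0 yM.
  rewrite /inner /inner_e y0 yM big_geq // big_ord0; ring.
rewrite /inner /inner_e y0 yM !mulr0 add0r addr0 -mulrN; congr (_ * _).
set h := step X0 X1 n.+1.
have -> : \sum_(j < n.+1) phi j * D_h X0 X1 y j =
    h^-1 * \sum_(0 <= j < n.+1) ev phi j * (ev y j.+1 - ev y j).
  rewrite big_mkord mulr_sumr; apply: eq_bigr => j _.
  have -> : ev phi j = phi j by rewrite ev_lt; congr phi; apply: val_inj.
  by rewrite /D_h -/h; ring.
rewrite abel_summation (ev_ord0 y) (ev_ord_max y) y0 yM !mulr0
  subr0 add0r mulrN opprK.
rewrite mulr_sumr; apply: eq_big_nat => i /andP[i1 iM].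
rewrite (ev_lt _ (ltnW iM : (i < n.+2)%N)) /d_h /= i1 iM /= -/h.
by rewrite [RHS]mulrCA mulrA mulrAC -mulrA.
Qed.

(** * Energies that are sums of functions of the difference quotient *)

Definition gradient_energy (R : realType) (X0 X1 : R) (M : nat)
    (e : 'I_M -> R -> R) (x : nodal R M) : R :=
  step X0 X1 M * \sum_(j < M) e j (D_h X0 X1 x j).

(** Along the line [x + s y] each difference quotient is affine in [s], so [E]
    is a sum of one-variable compositions; summation by parts then turns the
    pairing with [D_h y] into one with [y]. *)
Lemma gradient_energy_variation (R : realType) (X0 X1 : R) (M : nat)
    (e : 'I_M -> R -> R) (phi : halfnodal R M) (x : nodal R M) :
  (forall j, is_derive (D_h X0 X1 x j) 1 (e j) (phi j)) ->
  is_variational_derivative X0 X1 (gradient_energy X0 X1 e) x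
    (fun i => - d_h X0 X1 phi i).
Proof.
move=> de y y0 yM.
have -> : (fun i => - d_h X0 X1 phi i) = d_h X0 X1 (fun j => - phi j).
  by apply/funext => i; rewrite d_hN.
rewrite inner_d_h //.
have de_line j : is_derive (0 : R) 1
    (fun s : R => e j (D_h X0 X1 x j + s * D_h X0 X1 y j))
    (phi j * D_h X0 X1 y j).
  apply: (@is_derive1_comp _ (e j)
    (fun s : R => D_h X0 X1 x j + s * D_h X0 X1 y j)).
    by rewrite mul0r addr0.
  set a := D_h X0 X1 x j; set b := D_h X0 X1 y j.
  have -> : (fun s : R => a + s * b) = cst a + b \*: id.
    by apply/funext => s; rewrite !fctE mulrC.
  by apply: is_derive_eq; rewrite add0r; exact: mulr1.
have := is_deriveZ (step X0 X1 M) (is_derive_sum de_line).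
rewrite fct_sumE => dE.
have -> : (fun s => gradient_energy X0 X1 e (fun i => x i + s * y i)) =
    step X0 X1 M \*: (fun s => \sum_(j < M)
      e j (D_h X0 X1 x j + s * D_h X0 X1 y j)).
  apply/funext => s; rewrite /gradient_energy /=; congr (_ * _).
  by apply: eq_bigr => j _; rewrite D_h_comb.
apply: is_derive_eq; rewrite /inner_e -mulrN -sumrN; congr (_ * _).
by apply: eq_bigr => j _; rewrite mulNr opprK.
Qed.

(** The last hypothesis is the tangent inequality of the convex [e j] at the
    new difference quotient, with slope [phi j]; the one before it is the
    scheme, with [phi] at the new time. *)
Lemma gradient_energy_dissipation (R : realType) (X0 X1 tau : R) (M : nat)
    (e : 'I_M -> R -> R) (phi : halfnodal R M) (w x x' : nodal R M) :
  0 < step X0 X1 M -> 0 < tau ->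
  x' ord0 = x ord0 -> x' ord_max = x ord_max ->
  (forall i : 'I_M.+1, (1 <= i <= M - 1)%N ->
     w i * velocity tau x x' i = d_h X0 X1 phi i) ->
  (forall j, e j (D_h X0 X1 x' j) - e j (D_h X0 X1 x j)
     <= phi j * (D_h X0 X1 x' j - D_h X0 X1 x j)) ->
  (gradient_energy X0 X1 e x' - gradient_energy X0 X1 e x) / tau
    <= - dissipation X0 X1 tau w x x'.
Proof.
move=> h_gt0 tau_gt0 xx0 xxM scheme tangent.
have v0 : velocity tau x x' ord0 = 0 by rewrite /velocity xx0 subrr mul0r.
have vM : velocity tau x x' ord_max = 0 by rewrite /velocity xxM subrr mul0r.
have -> : dissipation X0 X1 tau w x x' =
    inner X0 X1 (d_h X0 X1 phi) (velocity tau x x').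
  rewrite /dissipation /inner v0 vM !mulr0; congr (_ * (_ + _ + _)).
  apply: eq_big_nat => i /andP[i1 iM]; congr (_ * _).
  rewrite !(ev_lt _ (ltnW iM : (i < M.+1)%N)) scheme //=.
  by rewrite i1 leq_subRL ?(leq_ltn_trans _ iM) // add1n.
rewrite inner_d_h // opprK /gradient_energy /inner_e -mulrBr -mulrA.
rewrite ler_pM2l // -sumrB mulr_suml; apply: ler_sum => j _.
by rewrite D_h_velocity mulrA ler_pM2r ?invr_gt0.
Qed.

(** * The logarithmic and the quadratic energy densities *)

Lemma log_density_tangent (R : realType) (f a b : R) :
  0 < f -> 0 < a -> 0 < b ->
  f * ln (f / b) - f * ln (f / a) <= - (f / b) * (b - a).
Proof.
move=> f0 a0 b0; rewrite -mulrBr !ln_div ?posrE //.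
have -> : - (f / b) * (b - a) = f * (a / b - 1) by field; rewrite gt_eqF.
have -> : ln f - ln b - (ln f - ln a) = ln (a / b).
  by rewrite ln_div ?posrE //; ring.
rewrite ler_pM2l //.
have ab : 0 < a / b by rewrite divr_gt0.
have := @le_ln1Dx R (a / b - 1); rewrite [1 + _]addrC subrK; apply.
by lra.
Qed.

Lemma log_density_derive (R : realType) (f a : R) : 0 < f -> 0 < a ->
  is_derive a 1 (fun b => f * ln (f / b)) (- (f / a)).
Proof.
move=> f0 a0.
have dquot : is_derive a 1 (fun b : R => f * b^-1) (f * (- a ^- 2 * 1)).
  by apply: (is_deriveZ f (is_deriveV _ _)); rewrite gt_eqF.
have dln := is_derive1_ln (divr_gt0 f0 a0).
have dlnq := @is_derive1_comp _ (@ln R) (fun b : R => f * b^-1) _ _ _ dln dquot.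
apply: (is_derive_eq (is_deriveZ f dlnq)).
by rewrite -[_ *: _]/(_ * _); field; rewrite !gt_eqF.
Qed.

Lemma quadratic_density_tangent (R : realType) (f a b : R) : 0 < f ->
  2^-1 * (b / f * b) - 2^-1 * (a / f * a) <= b / f * (b - a).
Proof.
move=> f0; rewrite -subr_ge0.
have -> : b / f * (b - a) - (2^-1 * (b / f * b) - 2^-1 * (a / f * a)) =
    2^-1 * (f^-1 * (b - a) ^+ 2) by field; rewrite gt_eqF.
by rewrite pmulr_rge0 ?invr_gt0 ?ltr0n // pmulr_rge0 ?invr_gt0 // sqr_ge0.
Qed.

Lemma quadratic_density_derive (R : realType) (f a : R) :
  is_derive a 1 (fun b => 2^-1 * (b / f * b)) (a / f).
Proof.
have dq := is_deriveZ (2^-1 * f^-1) (is_deriveX 2 (is_derive_id a (1 : R))).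
have -> : (fun b => 2^-1 * (b / f * b)) = (2^-1 * f^-1) \*: id ^+ 2.
  by apply/funext => b; rewrite !fctE -[RHS]/(_ * _); ring.
apply: (is_derive_eq dq); rewrite -[LHS]/(_ * (_ * _)) /=.
by move: f^-1 => g; field.
Qed.

(** * The two schemes *)

Lemma step_gt0 (R : realType) (X0 X1 : R) (M : nat) :
  X0 < X1 -> (0 < M)%N -> 0 < step X0 X1 M.
Proof. by move=> hX hM; rewrite divr_gt0 ?subr_gt0 ?ltr0n. Qed.

Lemma halfnode_itv (R : realType) (X0 X1 : R) (bl br : bool) (M : nat)
    (j : 'I_M) : X0 < X1 ->
  X0 + (j%:R + 2^-1) * step X0 X1 M \in Interval (BSide bl X0) (BSide br X1).
Proof.
move=> hX; have hM : (0 < M)%N by apply: leq_ltn_trans (ltn_ord j).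
have h0 := step_gt0 hX hM.
have hMh : M%:R * step X0 X1 M = X1 - X0.
  by rewrite /step mulrCA divff ?mulr1 // pnatr_eq0 -lt0n.
have jM : j%:R + 1 <= M%:R :> R by rewrite natr1 ler_nat.
have lo : X0 < X0 + (j%:R + 2^-1) * step X0 X1 M.
  by rewrite ltrDl mulr_gt0 // ltr_wpDl.
have hi : X0 + (j%:R + 2^-1) * step X0 X1 M < X1.
  by rewrite -ltrBrDl -hMh ltr_pM2r //; lra.
rewrite itv_boundlr /= /Order.le /=.
by case: bl; case: br; rewrite /= ?lo ?hi ?ltW.
Qed.

Lemma D_h_gt0 (R : realType) (X0 X1 : R) (M : nat) (x : nodal R M) (j : 'I_M) :
  0 < step X0 X1 M -> increasing_grid x -> 0 < D_h X0 X1 x j.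
Proof.
by move=> h0 incx; rewrite divr_gt0 // subr_gt0; apply: (incx j.+1) => /=.
Qed.

Lemma energy1E (R : realType) (X0 X1 : R) (M : nat) (f0 : R -> R) :
  energy1 X0 X1 f0 = gradient_energy X0 X1 (fun (j : 'I_M) a =>
    at_halfnodes X0 X1 f0 j * ln (at_halfnodes X0 X1 f0 j / a)).
Proof. by []. Qed.

Lemma energy2E (R : realType) (X0 X1 : R) (M : nat) (f0 : R -> R) :
  energy2 X0 X1 f0 = gradient_energy X0 X1 (fun (j : 'I_M) a =>
    2^-1 * (a / at_halfnodes X0 X1 f0 j * a)).
Proof.
apply/funext => x; rewrite /energy2 /inner_e /gradient_energy mulrCA.
by rewrite -mulr_sumr.
Qed.

Theorem theorem4p2 (R : realType) (X0 X1 : R) (bl br : bool) (hX : X0 < X1)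
    (T : R) (hT : 0 < T) (N M : nat) (hN : (0 < N)%N) (hM : (0 < M)%N)
    (m : R) (hm : 1 < m) (f0 : R -> R)
    (f0_pos : forall z : R,
       z \in Interval (BSide bl X0) (BSide br X1) -> 0 < f0 z)
    (f0_bounded :
       [bounded f0 z | z in [set` Interval (BSide bl X0) (BSide br X1)]])
    (n : nat) (hn : (n < N)%N) :
  let tau := T / N%:R in
  (* Case 1 *)
  ((forall x : nat -> nodal R M,
      admissible X0 X1 (x n) -> admissible X0 X1 (x n.+1) ->
      scheme1 X0 X1 f0 m tau (x n) (x n.+1) ->
      (energy1 X0 X1 f0 (x n.+1) - energy1 X0 X1 f0 (x n)) / tau
        <= - dissipation X0 X1 tau (mobility1 X0 X1 f0 m (x n)) (x n) (x n.+1))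
   /\ (forall x : nodal R M, increasing_grid x ->
         is_variational_derivative X0 X1 (energy1 X0 X1 f0) x
           (d_h X0 X1 (fun j => at_halfnodes X0 X1 f0 j / D_h X0 X1 x j))))
  /\
  (* Case 2 *)
  ((forall x : nat -> nodal R M,
      admissible X0 X1 (x n) -> admissible X0 X1 (x n.+1) ->
      scheme2 X0 X1 f0 m tau (x n) (x n.+1) ->
      (energy2 X0 X1 f0 (x n.+1) - energy2 X0 X1 f0 (x n)) / tau
        <= - dissipation X0 X1 tau (mobility2 X0 X1 f0 m (x n)) (x n) (x n.+1))
   /\ (forall x : nodal R M,
         is_variational_derivative X0 X1 (energy2 X0 X1 f0) x
           (fun i => - d_h X0 X1
              (fun j => D_h X0 X1 x j / at_halfnodes X0 X1 f0 j) i))).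
Proof.
move=> tau.
have tau_gt0 : 0 < tau by rewrite divr_gt0 ?ltr0n.
have h_gt0 := step_gt0 hX hM.
have f_gt0 j : 0 < @at_halfnodes R X0 X1 M f0 j.
  by apply: f0_pos; apply: halfnode_itv.
rewrite energy1E energy2E; split; split.
- move=> x [inc x0 xM] [inc' _ _] [sch x'0 x'M].
  apply: (@gradient_energy_dissipation _ _ _ _ _ _
    (fun j => - flux1 X0 X1 f0 (x n.+1) j)) => //.
  + by rewrite x0.
  + by rewrite xM.
  + by move=> i i_in; rewrite sch // d_hN.
  + by move=> j; apply: log_density_tangent => //; apply: D_h_gt0.
- move=> x inc.
  have -> : d_h X0 X1 (fun j => at_halfnodes X0 X1 f0 j / D_h X0 X1 x j) =
      fun i => - d_h X0 X1
        (fun j => - (at_halfnodes X0 X1 f0 j / D_h X0 X1 x j)) i.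
    by apply/funext => i; rewrite d_hN opprK.
  apply: gradient_energy_variation => j.
  by apply: log_density_derive => //; apply: D_h_gt0.
- move=> x [_ x0 xM] _ [sch x'0 x'M].
  apply: (@gradient_energy_dissipation _ _ _ _ _ _
    (flux2 X0 X1 f0 (x n.+1))) => //.
  + by rewrite x0.
  + by rewrite xM.
  + by move=> j; apply: quadratic_density_tangent.
- move=> x; apply: gradient_energy_variation => j.
  exact: quadratic_density_derive.
Qed.
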